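(* Let $n \geq 3$ be an integer and let $q \geq 3$ be a prime power. Let $G_{\mathrm{pr}}(\mathbb{F}_q^n)$ be the phase-rotation distance graph, and let $\alpha_3$ denote the $3$-independence number. Then \[ \alpha_3(G_{\mathrm{pr}}(\mathbb{F}_q^n)) \leq q^n\, \frac{n(n+2q-1)+q \lceil \tfrac{n-1}{q} \rceil \big(-2n-q+q \lceil \tfrac{n-1}{q} \rceil \big)}{q^3 \big( n+\lfloor \tfrac{1-n}{q} \rfloor \big) \big( n+1+ \lfloor \tfrac{1-n}{q} \rfloor \big)}. \]
   Context: Let $\mathbf{e}_1,\ldots,\mathbf{e}_n$ be the standard basis of $\mathbb{F}_q^n$ and $\mathbf{1}$ the all-ones vector. Put $F_i=\mathrm{span}(\mathbf{e}_i)$ for $i=1,\ldots,n$ and $F_{n+1}=\mathrm{span}(\mathbf{1})$. The phase-rotation weight of $\mathbf{x}\in\mathbb{F}_q^n$ is $w_{\mathrm{pr}}(\mathbf{x})=\min\{|I| : I\subseteq\{1,\ldots,n+1\},\ \mathbf{x}\in\mathrm{span}(\bigcup_{i\in I}F_i)\}$, and the phase-rotation distance is $d_{\mathrm{pr}}(\mathbf{x},\mathbf{y})=w_{\mathrm{pr}}(\mathbf{x}-\mathbf{y})$. The phase-rotation distance graph $G_{\mathrm{pr}}(\mathbb{F}_q^n)$ is the graph with vertex set $\mathbb{F}_q^n$ in which $\mathbf{x},\mathbf{y}$ are adjacent if and only if $d_{\mathrm{pr}}(\mathbf{x},\mathbf{y})=1$. For a graph $G$, the $k$-independence number $\alpha_k(G)$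 is the size of the largest set of vertices such that any two distinct vertices in the set are at geodesic distance greater than $k$ in $G$. *)

(* Defs.v *)
From HB Require Import structures.
From mathcomp Require Import all_boot all_order all_algebra.
Set Implicit Arguments. Unset Strict Implicit. Unset Printing Implicit Defensive.
Import Order.TTheory GRing.Theory Num.Theory.
Local Open Scope ring_scope.

Section GraphDistance.
Variables (T : finType) (e : rel T).

Definition walk (m : nat) (x y : T) : bool :=
  [exists p : m.-tuple T, path e x p && (last x p == y)].

Lemma connect_walk x y : connect e x y -> exists m, walk m x y.
Proof.
case/connectP=> p ep ->; exists (size p); apply/existsP.
by exists (in_tuple p); rewrite /= ep eqxx.
Qed.

(* [None] is the infinite distance between two distinct components. *)
Definition geodist (x y : T) : option nat :=
  match @idP (connect e x y) with
  | ReflectT xy => Some (ex_minn (connect_walk xy))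
  | ReflectF _ => None
  end.

Definition geodist_gt (k : nat) (x y : T) : bool :=
  if geodist x y is Some d then (k < d)%N else true.

Definition k_independent (k : nat) (S : {set T}) : bool :=
  [forall x in S, forall y in S, (x != y) ==> geodist_gt k x y].

Definition k_independence_number (k : nat) : nat :=
  \max_(S : {set T} | k_independent k S) #|S|.

End GraphDistance.

Section PhaseRotation.
Variables (F : finFieldType) (n : nat).

(* The lines are indexed from 0; the last index, [ord_max], is the line
   spanned by the all-ones vector. *)
Definition pr_line (i : 'I_n.+1) : {vspace 'rV[F]_n} :=
  if unlift ord_max i is Some j then <[(delta_mx 0 j)%R]>%VS
  else <[(const_mx 1)%R]>%VS.

(* The sum of the subspaces is the span of their union. *)
Definition pr_span (I : {set 'I_n.+1}) : {vspace 'rV[F]_n} :=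
  (\sum_(i in I) pr_line i)%VS.

Lemma mem_pr_spanT (x : 'rV[F]_n) : x \in pr_span [set: 'I_n.+1].
Proof.
rewrite (row_sum_delta x); apply: memv_suml => j _; apply: memvZ.
have /subvP -> // : (pr_line (lift ord_max j) <= pr_span setT)%VS.
  by apply: sumv_sup (in_setT _) _.
by rewrite /pr_line liftK memv_line.
Qed.

(* [setT] is only the admissible witness required by [arg min];
   see [mem_pr_spanT]. *)
Definition pr_weight (x : 'rV[F]_n) : nat :=
  #|[arg min_(I < [set: 'I_n.+1] | x \in pr_span I) #|I|]%N|.

Lemma pr_weightP (x : 'rV[F]_n) :
  (exists2 I : {set 'I_n.+1}, x \in pr_span I & #|I| = pr_weight x) /\
  (forall I : {set 'I_n.+1}, x \in pr_span I -> (pr_weight x <= #|I|)%N).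
Proof.
rewrite /pr_weight; case: arg_minnP; first exact: mem_pr_spanT.
by move=> I xI min_I; split=> //; exists I.
Qed.

Definition pr_dist (x y : 'rV[F]_n) : nat := pr_weight (x - y).

Definition pr_graph : rel 'rV[F]_n := fun x y => pr_dist x y == 1%N.

End PhaseRotation.

Arguments pr_graph : clear implicits.

(* Main.v *)
Require Import Defs.
From HB Require Import structures.
From mathcomp Require Import all_boot all_order all_algebra.
From mathcomp Require Import ring lra.
(* Ratio-type bound. Let P_i be the operator averaging a function on F^n over
   the cosets of the i-th line, so that the adjacency operator of the graph is
   q * Z - (n + 1) with Z = \sum_i P_i. The P_i are commuting orthogonal
   projections, hence Z is diagonalized, with eigenvalues in {0, ..., n + 1},
   by the products of the P_i, i in K, and the 1 - P_i, i notin K.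
   With a = ceil((n - 1) / q), the cubic p(z) = z (z - a) (z - a - 1) is
   nonnegative on the integers, so that, for the indicator f of a set S,
   <f, p(Z) f> is at least p(n + 1) times the squared norm |S|^2 / q^n of the mean of f.
   If S is 3-independent, then a product of k <= 3 distinct P_i contributes
   exactly |S| / q^k to <f, p(Z) f>: its kernel is q^-k on the span of the k
   lines, which are linearly independent and meet S - S only in 0. *)

Set Implicit Arguments. Unset Strict Implicit. Unset Printing Implicit Defensive.
Import Order.TTheory GRing.Theory Num.Theory.
Local Open Scope ring_scope.

(** * Joint spectral decomposition of commuting orthogonal projections *)

Section CommutingIdempotents.
Variables (R : realDomainType) (N : nat) (I : finType).
Implicit Types (G P : I -> 'M[R]_N) (f : 'cV[R]_N) (J K : {set I}).

Definition quadratic_form (f : 'cV[R]_N) (A : 'M[R]_N) : R :=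
  (f^T *m A *m f) 0 0.

Lemma quadratic_form_sum (T : finType) (D : pred T) (A : T -> 'M[R]_N) f :
  quadratic_form f (\sum_(t | D t) A t) =
  \sum_(t | D t) quadratic_form f (A t).
Proof. by rewrite /quadratic_form mulmx_sumr mulmx_suml summxE. Qed.

Lemma quadratic_formZ c (A : 'M[R]_N) f :
  quadratic_form f (c *: A) = c * quadratic_form f A.
Proof. by rewrite /quadratic_form -scalemxAr -scalemxAl mxE. Qed.

Lemma quadratic_form_ge0 (A : 'M[R]_N) f :
  A^T = A -> A * A = A -> 0 <= quadratic_form f A.
Proof.
rewrite /quadratic_form => symA idA.
have -> : f^T *m A *m f = (A *m f)^T *m (A *m f).
  by rewrite -{1}idA trmx_mul symA !mulmxA.
by rewrite mxE sumr_ge0 // => i _; rewrite mxE -expr2 sqr_ge0.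
Qed.

Lemma prod_comm_sym_idem (r : seq I) G :
    (forall i, (G i)^T = G i) -> (forall i, G i * G i = G i) ->
    (forall i j, GRing.comm (G i) (G j)) ->
  (\prod_(i <- r) G i)^T = \prod_(i <- r) G i /\
  \prod_(i <- r) G i * \prod_(i <- r) G i = \prod_(i <- r) G i.
Proof.
move=> symG idG comG.
have comX i s : GRing.comm (G i) (\prod_(j <- s) G j).
  by apply: commr_prod => j _; apply: comG.
elim: r => [|i r [IHs IHi]]; first by rewrite big_nil trmx1 mulr1.
rewrite !big_cons; set X := \prod_(j <- r) _ in IHs IHi *.
have cX : G i * X = X * G i by apply: comX.
split; first by rewrite [LHS]trmx_mul symG IHs; apply/esym/cX.
by rewrite mulrA -(mulrA (G i)) -cX !mulrA idG -mulrA IHi.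
Qed.

(* Expand [\prod_i (P i + (1 - P i))]: the products of the [P i], [i \in K], and
   of the [1 - P i], [i \notin K], are orthogonal projections. *)
Lemma comm_projections_decomposition P f :
    (forall i, (P i)^T = P i) -> (forall i, P i * P i = P i) ->
    (forall i j, GRing.comm (P i) (P j)) ->
  exists2 e : {set I} -> R, (forall K, 0 <= e K) &
    forall J, quadratic_form f (\prod_i (if i \in J then P i else 1)) =
      \sum_(K : {set I} | J \subset K) e K.
Proof.
move=> symP idP comP.
pose G K i := if i \in K then P i else 1 - P i.
exists (fun K => quadratic_form f (\prod_i G K i)) => [K|J].
  have comPB i j : GRing.comm (P i) (1 - P j).
    by apply: commrB; [apply: commr1 | apply: comP].
  have [||| symE idE] := @prod_comm_sym_idem (index_enum I) (G K).
  - move=> i; rewrite /G; case: ifP => _; first exact: symP.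
    by rewrite linearB /= symP trmx1.
  - move=> i; rewrite /G; case: ifP => _; first exact: idP.
    by rewrite mulrBl !mulrBr !mulr1 !mul1r idP subrr subr0.
  - move=> i j; rewrite /G; case: ifP => _; case: ifP => _ //.
    + exact/commr_sym/comPB.
    + apply: commrB; first exact: commr1.
      exact/commr_sym/comPB.
  exact: quadratic_form_ge0.
rewrite -quadratic_form_sum; congr quadratic_form.
(* For [i \in J] the second summand is [0], so the expansion kills every [K] that does not contain
   [J]. *)
under eq_bigr => i _.
  rewrite (_ : (if _ then _ else _) = P i + (if i \in J then 0 else 1 - P i)).
    over.
  by case: ifP => _; rewrite ?addr0 // addrC subrK.
rewrite bigA_distr big_mkcond [RHS]big_mkcond /=.
apply: eq_bigr => K _; case: ifP => [/subsetP JK | /negbT /subsetPn [i iJ iK]].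
  apply: eq_bigr => i _; rewrite /G; case: ifP => // /negbT.
  by case: (boolP (i \in J)) => // /JK ->.
(* [bigD1] is not available in a noncommutative ring *)
have : i \in index_enum I by rewrite mem_index_enum.
elim: (index_enum I) => // j r IH; rewrite inE big_cons.
case: eqP => [<- _ | _ /IH ->]; last by rewrite mulr0.
by rewrite (negPf iK) iJ mul0r.
Qed.

(** Double counting: a fixed [K] contains ['C(#|K|, k)] sets [J] of size [k]. This turns sums of
    [k]-fold products of projections into spectral sums. *)
Lemma sum_card_supersets (e : {set I} -> R) k :
  \sum_(J : {set I} | #|J| == k) \sum_(K : {set I} | J \subset K) e K =
  \sum_(K : {set I}) 'C(#|K|, k)%:R * e K.
Proof.
rewrite (exchange_big_dep predT) //=; apply: eq_bigr => K _.
rewrite sumr_const mulr_natl; congr (_ *+ _).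
by rewrite -cards_draws cardsE; apply: eq_card => J; rewrite !unfold_in andbC.
Qed.

End CommutingIdempotents.

(** * Translations and averages over lines *)

Section LineAverages.
Variables (F : finFieldType) (V : finLmodType F).
Local Notation q := (#|F|%:R : rat).
Implicit Types (v w : V) (S : {set V}).

Definition shift w : 'M[rat]_#|V| :=
  \matrix_(a, b) (enum_val a - enum_val b == w)%:R.

Definition indicator S : 'cV[rat]_#|V| := \col_a (enum_val a \in S)%:R.

(** Summing over scalars rather than over the vectors of the line makes this a projection for every
    [v]; it is the identity for [v = 0]. *)
Definition line_average v : 'M[rat]_#|V| :=
  \sum_(t : F) q^-1 *: shift (t *: v).

Lemma card_field_neq0 : q != 0.
Proof. by rewrite pnatr_eq0 -lt0n; apply/card_gt0P; exists 0. Qed.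

Lemma shift0 : shift 0 = 1.
Proof.
by apply/matrixP=> a b; rewrite !mxE subr_eq0 (inj_eq enum_val_inj).
Qed.

Lemma shiftD v w : shift (v + w) = shift v * shift w.
Proof.
apply/matrixP=> a b; rewrite !mxE.
rewrite (bigD1 (enum_rank (enum_val a - v))) //= !mxE enum_rankK opprB.
rewrite addrCA subrr addr0 eqxx mul1r big1 ?addr0 => [|c ca].
  by rewrite (addrC v) -subr_eq addrAC.
rewrite !mxE; case: eqP => [av|_]; last by rewrite mul0r.
by case/eqP: ca; rewrite -av opprB addrCA subrr addr0 enum_valK.
Qed.

Lemma tr_shift w : (shift w)^T = shift (- w).
Proof. by apply/matrixP=> a b; rewrite !mxE -eqr_opp opprB. Qed.

Lemma shift_comm v w : GRing.comm (shift v) (shift w).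
Proof. by rewrite /GRing.comm -!shiftD addrC. Qed.

Lemma tr_line_average v : (line_average v)^T = line_average v.
Proof.
rewrite /line_average linear_sum /= (reindex_inj oppr_inj) /=.
by apply: eq_bigr => t _; rewrite linearZ /= tr_shift scaleNr opprK.
Qed.

Lemma line_average_idem v : line_average v * line_average v = line_average v.
Proof.
rewrite /line_average mulr_suml.
have absorb s : q^-1 *: shift (s *: v) * (\sum_(t : F) q^-1 *: shift (t *: v)) =
    q^-1 *: \sum_(t : F) q^-1 *: shift (t *: v).
  rewrite -mulmxE -scalemxAl; congr (_ *: _).
  rewrite mulmx_sumr [RHS](reindex_inj (addrI s)) /=.
  by apply: eq_bigr => t _; rewrite -scalemxAr mulmxE -shiftD scalerDl.
under eq_bigr => s _ do rewrite absorb.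
rewrite sumr_const -scaler_nat scalerA divff ?scale1r //.
exact: card_field_neq0.
Qed.

Lemma line_average_comm v w : GRing.comm (line_average v) (line_average w).
Proof.
apply: commr_sum => t _; apply/commr_sym/commr_sum => s _.
by rewrite /GRing.comm -!mulmxE -!scalemxAl -!scalemxAr mulmxE shift_comm.
Qed.

Lemma prod_scaled_shift (I : Type) (r : seq I) (c : I -> rat) (w : I -> V) :
  \prod_(i <- r) (c i *: shift (w i)) =
  (\prod_(i <- r) c i) *: shift (\sum_(i <- r) w i).
Proof.
elim: r => [|i r IH]; first by rewrite !big_nil shift0 scale1r.
by rewrite !big_cons IH shiftD -!mulmxE -scalemxAl -scalemxAr scalerA.
Qed.

Lemma quadratic_form_shift S w :
  quadratic_form (indicator S) (shift w) =
  \sum_(x in S) \sum_(y in S) (x - y == w)%:R.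
Proof.
rewrite /quadratic_form -mulmxA mxE.
rewrite [RHS]big_mkcond [RHS](reindex _ (onW_bij _ (enum_val_bij V))) /=.
apply: eq_bigr => a _; rewrite !mxE.
case: ifP => _; last by rewrite mul0r.
rewrite mul1r [RHS]big_mkcond [RHS](reindex _ (onW_bij _ (enum_val_bij V))) /=.
apply: eq_bigr => b _; rewrite !mxE.
by case: ifP => _; rewrite ?mulr1 ?mulr0.
Qed.

Definition combination (I : finType) (v : I -> V) (t : I -> F) : V :=
  \sum_i t i *: v i.

(** Families of coefficients supported on [J], kept indexed by all of [I] as they arise from
    distributing a product over [I]. *)
Definition coef_family (I : finType) (J : {set I}) :=
  [pred t : {ffun I -> F} | [forall i, (i \in J) || (t i == 0)]].

(** The product expands into one shift per coefficient family, and the form of a shift counts the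
    pairs in [S] with that difference. *)
Lemma quadratic_form_averages (I : finType) (v : I -> V) (J : {set I}) S :
  quadratic_form (indicator S)
      (\prod_i (if i \in J then line_average (v i) else 1)) =
  q^-1 ^+ #|J| * \sum_(x in S) \sum_(y in S)
     \sum_(t in coef_family J) (x - y == combination v t)%:R.
Proof.
pose c i : rat := if i \in J then q^-1 else 1.
(* The identity is written as a sum over the single scalar [0], so that every factor is a sum of
   scaled shifts. *)
under eq_bigr => i _.
  rewrite (_ : (if _ then _ else _) =
    \sum_(s : F | (i \in J) || (s == 0)) c i *: shift (s *: v i)).
    over.
  rewrite /c; case: ifP => _ //=.
  by rewrite big_pred1_eq scale0r shift0 scale1r.
rewrite bigA_distr_big_dep quadratic_form_sum.
transitivity (\sum_(t in coef_family J) q^-1 ^+ #|J| *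
     \sum_(x in S) \sum_(y in S) (x - y == combination v t)%:R : rat).
  apply: eq_big => [t|t _]; first by rewrite !unfold_in.
  rewrite prod_scaled_shift quadratic_formZ quadratic_form_shift.
  by rewrite /c -big_mkcond prodr_const.
rewrite -mulr_sumr exchange_big; congr (_ * _).
by apply: eq_bigr => x _; rewrite exchange_big.
Qed.

End LineAverages.

(** * Walks and geodesic distance *)

Lemma geodist_gtN (T : finType) (e : rel T) k (x y : T) (p : seq T) :
  path e x p -> last x p = y -> (size p <= k)%N -> ~~ geodist_gt e k x y.
Proof.
move=> ep pe sp; rewrite /geodist_gt /geodist.
case: {-}_ / idP => [xy|]; last by case; apply/connectP; exists p.
case: ex_minnP => d _ /(_ (size p)) dmin; rewrite -leqNgt.
apply: leq_trans sp; apply: dmin; apply/existsP.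
by exists (in_tuple p); rewrite /= ep pe eqxx.
Qed.

(** * The cubic in the binomial basis *)

Lemma natr_bin2 (k : nat) : 2 * 'C(k, 2)%:R = k%:R * (k%:R - 1) :> rat.
Proof.
elim: k => [|k IH]; first by rewrite mul0r mulr0.
by rewrite binS bin1 natrD mulrDr IH -natr1; ring.
Qed.

Lemma natr_bin3 (k : nat) :
  6 * 'C(k, 3)%:R = k%:R * (k%:R - 1) * (k%:R - 2) :> rat.
Proof.
elim: k => [|k IH]; first by rewrite !mul0r mulr0.
rewrite binS natrD mulrDr IH.
have -> : 6 * 'C(k, 2)%:R = 3 * (2 * 'C(k, 2)%:R) :> rat by ring.
by rewrite natr_bin2 -natr1; ring.
Qed.

(* [k * (k - a) * (k - (a + 1))] in the basis of binomials: the coefficient of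
   ['C(k, j)] multiplies the sum of the [j]-fold products of line averages. *)
Definition cubic (a : int) (k : nat) : rat :=
  6 * 'C(k, 3)%:R + (4 - 4 * a%:~R) * 'C(k, 2)%:R
  + (a%:~R ^+ 2 - a%:~R) * 'C(k, 1)%:R.

Lemma cubicE a k :
  cubic a k = k%:R * ((k%:R - a%:~R) * (k%:R - a%:~R - 1)).
Proof.
rewrite /cubic natr_bin3 bin1.
have -> : (4 - 4 * a%:~R) * 'C(k, 2)%:R =
  (2 - 2 * a%:~R) * (2 * 'C(k, 2)%:R) :> rat by ring.
by rewrite natr_bin2; ring.
Qed.

(** The factors [k - a] and [k - a - 1] are consecutive integers, so they never have strictly
    opposite signs. *)
Lemma cubic_ge0 a k : 0 <= cubic a k.
Proof.
rewrite cubicE mulr_ge0 ?ler0n //.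
rewrite (_ : k%:R = k%:Z%:~R) //; have [ka|ka] := leP k%:Z a.
  have : k%:Z%:~R <= a%:~R :> rat by rewrite ler_int.
  by move=> le_ka; rewrite mulr_le0 //; lra.
have : (a + 1)%:~R <= k%:Z%:~R :> rat by rewrite ler_int lezD1.
by rewrite rmorphD /= => lt_ak; rewrite mulr_ge0 //; lra.
Qed.

(** * Linear combinations along the lines of the phase-rotation graph *)

Section PhaseRotationBound.
Variables (F : finFieldType) (n : nat).
Local Notation V := 'rV[F]_n.
Local Notation q := (#|F|%:R : rat).
Implicit Types (x y w : V) (S : {set V}) (J : {set 'I_n.+1}).

Definition pr_vector (i : 'I_n.+1) : V :=
  if unlift ord_max i is Some j then delta_mx 0 j else const_mx 1.

Lemma pr_lineE i : pr_line F i = <[pr_vector i]>%VS.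
Proof. by rewrite /pr_line /pr_vector; case: unlift. Qed.

(** A singleton of lines bounds the weight by one, and weight zero would put the nonzero [x - y] in
    the empty sum. *)
Lemma pr_graph_line x y i t :
  x != y -> x - y = t *: pr_vector i -> pr_graph F n x y.
Proof.
move=> xy xyt; rewrite /pr_graph /pr_dist.
have [[I xI <-] /(_ [set i])] := pr_weightP (x - y).
rewrite cards1 /pr_span big_set1 pr_lineE xyt memvZ ?memv_line // => /(_ isT).
rewrite leq_eqVlt ltnS leqn0 => /orP[//|]; rewrite cards_eq0 => /eqP I0.
by move: xI; rewrite I0 /pr_span big_set0 memv0 subr_eq0 (negPf xy).
Qed.

(** Subtract the terms one at a time. A zero term gives no edge and is skipped, hence only an upper
    bound on the length. *)
Lemma pr_graph_path (t : 'I_n.+1 -> F) (r : seq 'I_n.+1) x :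
  exists p, [/\ path (pr_graph F n) x p,
    last x p = x - \sum_(i <- r) t i *: pr_vector i & (size p <= size r)%N].
Proof.
elim: r x => [|i r IH] x; first by exists [::]; rewrite big_nil subr0.
have [p [ep lp sp]] := IH (x - t i *: pr_vector i).
have [xi|xi] := eqVneq (x - t i *: pr_vector i) x.
  rewrite xi in ep lp; exists p; split=> //; last exact: leq_trans sp _.
  by rewrite big_cons opprD addrA xi.
exists (x - t i *: pr_vector i :: p); split=> //=.
- by rewrite ep andbT (@pr_graph_line _ _ i (t i)) 1?eq_sym // subKr.
- by rewrite lp big_cons opprD addrA.
Qed.

Lemma combination_prE (t : {ffun 'I_n.+1 -> F}) j :
  combination pr_vector t 0 j = t (lift ord_max j) + t ord_max.
Proof.
rewrite /combination summxE (bigD1_ord ord_max) //= addrC.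
rewrite {2}/pr_vector unlift_none !mxE mulr1; congr (_ + _).
rewrite (bigD1 j) //= /pr_vector liftK !mxE !eqxx mulr1 big1 ?addr0 // => k kj.
by rewrite liftK !mxE eq_sym (negPf kj) andbF mulr0.
Qed.

(** Up to a scalar, the only relation says that the all-ones vector is the sum of the basis. All its
    coefficients are nonzero, so it is not supported on a proper subset [J]. *)
Lemma combination_pr_inj J (t : {ffun 'I_n.+1 -> F}) :
  (#|J| <= n)%N -> t \in coef_family F J -> combination pr_vector t = 0 ->
  t = 0.
Proof.
move=> Jn /forallP tJ t0.
have tj j : t (lift ord_max j) = - t ord_max.
  by apply/eqP; rewrite -addr_eq0 -combination_prE t0 mxE.
suff tm : t ord_max = 0.
  apply/ffunP=> i; rewrite ffunE.
  have [j|] := unliftP ord_max i; last by move->.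
  by move->; rewrite tj tm oppr0.
have [i iJ] : exists i, i \notin J.
  apply/existsP; rewrite -negb_forall; apply/negP=> /forallP allJ.
  have JE : #|J| = n.+1.
    by rewrite -[RHS]card_ord; apply: eq_card => i; rewrite allJ.
  by rewrite JE ltnn in Jn.
move: (tJ i); rewrite (negPf iJ) /=; have [j ->|->] := unliftP ord_max i.
  by rewrite tj oppr_eq0 => /eqP.
by move/eqP.
Qed.

(** Following the lines of [J] would join distinct [x] and [y] by a walk of length at most [k]. So
    [x = y], and linear independence applies. *)
Lemma independent_combination k S J x y (t : {ffun 'I_n.+1 -> F}) :
  k_independent (pr_graph F n) k S -> (#|J| <= k)%N -> (#|J| <= n)%N ->
  x \in S -> y \in S -> t \in coef_family F J ->
  x - y = combination pr_vector t -> t = 0.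
Proof.
move=> indS Jk Jn xS yS tJ xyt; apply: (combination_pr_inj Jn tJ).
suff /eqP xy : x == y by rewrite -xyt xy subrr.
apply: contraT => xy.
have := indS; move/forall_inP/(_ x xS)/forall_inP/(_ y yS)/implyP/(_ xy).
have [p [ep lp sp]] := pr_graph_path t (enum J) x.
apply: contraLR => _; apply: (geodist_gtN ep).
  rewrite lp big_enum /= -(subKr x y) xyt; congr (_ - _).
  rewrite /combination [RHS](bigID (mem J)) /= [X in _ = _ + X]big1 ?addr0 //.
  move=> i /negPf iJ; move/forallP/(_ i): tJ.
  by rewrite iJ => /eqP ->; rewrite scale0r.
by rewrite -cardE in sp; apply: leq_trans Jk.
Qed.

(** The coefficient of the all-ones vector is free and determines the others. *)
Lemma card_combination_fiber w :
  #|[set t : {ffun 'I_n.+1 -> F} | w == combination pr_vector t]| = #|F|.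
Proof.
pose g (s : F) : {ffun 'I_n.+1 -> F} :=
  [ffun i => if unlift ord_max i is Some j then w 0 j - s else s].
have g_inj : injective g.
  by move=> s s' /ffunP/(_ ord_max); rewrite !ffunE unlift_none.
rewrite -(card_imset predT g_inj); apply: eq_card => t; rewrite inE.
apply/eqP/imsetP => [wt|[s _ ->]].
  exists (t ord_max) => //; apply/ffunP=> i; rewrite ffunE.
  have [j ->|-> //] := unliftP ord_max i.
  by rewrite wt combination_prE addrK.
apply/rowP=> j; rewrite combination_prE !ffunE liftK unlift_none.
by rewrite subrK.
Qed.

(** * Quadratic forms of the indicator of an independent set *)

Local Notation Q S J := (quadratic_form (indicator S)
  (\prod_i (if i \in J then line_average (pr_vector i) else 1))).

(** Only the pairs [x = y] with zero coefficients survive in the count. *)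
Lemma quadratic_form_independent k S J :
  k_independent (pr_graph F n) k S -> (#|J| <= k)%N -> (#|J| <= n)%N ->
  Q S J = q^-1 ^+ #|J| * #|S|%:R.
Proof.
move=> indS Jk Jn; rewrite quadratic_form_averages; congr (_ * _).
rewrite -sumr_const; apply: eq_bigr => x xS.
have comb0 : combination pr_vector (0 : {ffun 'I_n.+1 -> F}) = 0.
  by rewrite /combination big1 // => i _; rewrite ffunE scale0r.
have t0 : (0 : {ffun 'I_n.+1 -> F}) \in coef_family F J.
  by apply/forallP=> i; rewrite ffunE eqxx orbT.
have unique y t : y \in S -> t \in coef_family F J ->
    x - y = combination pr_vector t -> t = 0.
  by move=> yS tJ; apply: (independent_combination indS Jk Jn xS yS tJ).
rewrite (bigD1 x) //= (bigD1 (0 : {ffun 'I_n.+1 -> F})) //=.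
rewrite comb0 subrr eqxx.
rewrite !big1 ?addr0 // => [y /andP[yS yx]|t /andP[tJ tn0]].
  rewrite big1 // => t tJ; case: eqP => // xyt.
  case/eqP: yx; apply/esym/eqP; rewrite -subr_eq0 xyt.
  by rewrite (unique y t yS tJ xyt) comb0.
case: eqP => // /esym t0E; case/eqP: tn0; apply: (unique x t xS tJ).
by rewrite subrr t0E.
Qed.

(** Each of the [#|S| ^ 2] pairs is reached by [q] families, which cancels one of the [n + 1]
    factors [q^-1]. *)
Lemma quadratic_form_full S :
  Q S [set: 'I_n.+1] = q^-1 ^+ n * #|S|%:R ^+ 2.
Proof.
rewrite quadratic_form_averages cardsT card_ord.
under eq_bigr => x _.
  under eq_bigr => y _.
    rewrite (_ : \sum_(t in _) _ = q); first over.
    rewrite -(card_combination_fiber (x - y)) -sum1_card natr_sum.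
    rewrite big_mkcond [RHS]big_mkcond /=; apply: eq_bigr => t _.
    rewrite inE; case: ifP => [_|/negbT/forallPn[i]]; last by rewrite inE.
    by rewrite inE; case: (_ == _).
  rewrite sumr_const; over.
rewrite sumr_const -mulrnA -[_ *+ (_ * _)]mulr_natr natrM -expr2 exprSr -mulrA.
by rewrite mulKf ?card_field_neq0.
Qed.

(** The right side is the form of the cubic in the sum of the averages; the left side is the term
    [K = setT] of its spectral sum, whose other terms are nonnegative. The condition [3 <= n] makes
    any three of the lines independent. *)
Lemma independent_cubic_bound S (a : int) :
  (3 <= n)%N -> k_independent (pr_graph F n) 3 S ->
  cubic a n.+1 * (q^-1 ^+ n * #|S|%:R ^+ 2) <=
  (6 * 'C(n.+1, 3)%:R * q^-1 ^+ 3
   + (4 - 4 * a%:~R) * 'C(n.+1, 2)%:R * q^-1 ^+ 2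
   + (a%:~R ^+ 2 - a%:~R) * 'C(n.+1, 1)%:R * q^-1) * #|S|%:R.
Proof.
move=> n3 indS.
have [e e_ge0 eE] := comm_projections_decomposition (indicator S)
  (fun i => tr_line_average (pr_vector i))
  (fun i => line_average_idem (pr_vector i))
  (fun i j => line_average_comm (pr_vector i) (pr_vector j)).
have eT : e setT = q^-1 ^+ n * #|S|%:R ^+ 2.
  rewrite -quadratic_form_full eE (bigD1 setT) //= big1 ?addr0 // => K.
  by rewrite subTset => /andP[-> ].
have ek k : (k <= 3)%N -> \sum_(K : {set 'I_n.+1}) 'C(#|K|, k)%:R * e K =
    'C(n.+1, k)%:R * (q^-1 ^+ k * #|S|%:R).
  move=> k3; rewrite -sum_card_supersets.
  transitivity (\sum_(J : {set 'I_n.+1} | #|J| == k) (q^-1 ^+ k * #|S|%:R)).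
    apply: eq_bigr => J /eqP Jk; rewrite -eE -Jk.
    by apply: (quadratic_form_independent indS); rewrite Jk // (leq_trans k3).
  rewrite sumr_const -[LHS]mulr_natl; congr (_%:R * _).
  by rewrite -[in RHS](card_ord n.+1) -card_draws cardsE.
have -> : (6 * 'C(n.+1, 3)%:R * q^-1 ^+ 3
   + (4 - 4 * a%:~R) * 'C(n.+1, 2)%:R * q^-1 ^+ 2
   + (a%:~R ^+ 2 - a%:~R) * 'C(n.+1, 1)%:R * q^-1) * #|S|%:R =
   \sum_(K : {set 'I_n.+1}) cubic a #|K| * e K.
  transitivity (6 * (\sum_(K : {set 'I_n.+1}) 'C(#|K|, 3)%:R * e K)
    + (4 - 4 * a%:~R) * (\sum_(K : {set 'I_n.+1}) 'C(#|K|, 2)%:R * e K)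
    + (a%:~R ^+ 2 - a%:~R) * (\sum_(K : {set 'I_n.+1}) 'C(#|K|, 1)%:R * e K)).
    by rewrite !ek // expr1; ring.
  rewrite !mulr_sumr -!big_split /=; apply: eq_bigr => K _.
  by rewrite /cubic; ring.
rewrite -eT (bigD1 setT) //= cardsT card_ord lerDl.
by apply: sumr_ge0 => K _; rewrite mulr_ge0 ?cubic_ge0.
Qed.

End PhaseRotationBound.

(** * Deduction of the bound on the independence number *)

Lemma k_independent1 (T : finType) (e : rel T) k (x : T) :
  k_independent e k [set x].
Proof.
apply/forall_inP=> y /set1P->; apply/forall_inP=> z /set1P->.
by rewrite eqxx.
Qed.

Theorem theorem49 (n q : nat) (F : finFieldType)
    (hn : (3 <= n)%N) (hq : (3 <= q)%N) (hF : #|F| = q) :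
  let N : rat := n%:R in
  let Q : rat := q%:R in
  let c : rat := (Num.ceil ((N - 1) / Q))%:~R in
  let f : rat := (Num.floor ((1 - N) / Q))%:~R in
  (k_independence_number (pr_graph F n) 3)%:R <=
    Q ^+ n * ((N * (N + 2 * Q - 1) + Q * c * (- 2 * N - Q + Q * c)) /
              (Q ^+ 3 * (N + f) * (N + 1 + f))).
Proof.
cbv zeta; set N : rat := n%:R; set Q : rat := q%:R.
set c : rat := (Num.ceil ((N - 1) / Q))%:~R.
set f : rat := (Num.floor ((1 - N) / Q))%:~R.
have fE : f = - c.
  by rewrite /f floorNceil -mulNr opprB rmorphN.
have Q_ge1 : 1 <= Q by rewrite /Q ler1n (leq_trans _ hq).
have N_ge3 : 3 <= N by rewrite /N ler_nat.
(* As [N - 1] is an integer, it suffices that [(N - 1) / Q <= N - 1]. This makes both denominators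
   [N - c] and [N + 1 - c] positive. *)
have cN : c <= N - 1.
  have -> : N - 1 = (n%:Z - 1)%:~R by rewrite rmorphB.
  rewrite ler_int ceil_le_int rmorphB /=.
  by rewrite ler_pdivrMr ?(lt_le_trans _ Q_ge1) // ler_peMr // subr_ge0; lra.
have Q_gt0 : 0 < Q by apply: lt_le_trans Q_ge1.
have Nc : 0 < N - c by lra.
have Nc1 : 0 < N + 1 - c by lra.
(* Nonemptiness allows one factor [#|S|] to be cancelled from the quadratic inequality. *)
have bound S : k_independent (pr_graph F n) 3 S -> (0 < #|S|)%N ->
    #|S|%:R <= Q ^+ n * ((N * (N + 2 * Q - 1) + Q * c * (- 2 * N - Q + Q * c)) /
              (Q ^+ 3 * (N + f) * (N + 1 + f))).
  move=> indS S_gt0; have s_gt0 : 0 < #|S|%:R :> rat by rewrite ltr0n.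
  have := independent_cubic_bound (Num.ceil ((N - 1) / Q)) hn indS.
  rewrite hF cubicE natr_bin3 bin1 -/c -/Q.
  have -> : (4 - 4 * c) * 'C(n.+1, 2)%:R * Q^-1 ^+ 2 =
    (2 - 2 * c) * (2 * 'C(n.+1, 2)%:R) * Q^-1 ^+ 2 by ring.
  rewrite natr_bin2 -natr1 -/N expr2 !mulrA ler_pM2r // => le_s.
  have Qn_gt0 : 0 < Q ^+ n by rewrite exprn_gt0.
  (* This is the value of the cubic at [n + 1] divided by [Q ^+ n], the coefficient of [#|S|] after
     the cancellation. *)
  have D_gt0 : 0 < (N + 1) * (N + 1 - c) * (N - c) / Q ^+ n.
    by rewrite divr_gt0 // !mulr_gt0 //; lra.
  rewrite -(ler_pM2l D_gt0); apply: le_trans (le_trans _ le_s) _.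
    by rewrite exprVn le_eqVlt; apply/orP; left; apply/eqP; ring.
  rewrite le_eqVlt; apply/orP; left; apply/eqP; rewrite fE.
  by field; rewrite !gt_eqF //; lra.
(* The bound for a singleton makes the right side at least [1], which settles the case of an empty
   maximizer. *)
have ge1 := le_trans _ (bound _ (k_independent1 (pr_graph F n) 3 0) _).
rewrite /k_independence_number.
have [|S indS ->] := @eq_bigmax_cond _ (k_independent (pr_graph F n) 3)
  (fun S => #|S|).
  by apply/card_gt0P; exists [set 0]; apply: k_independent1.
have [S0|] := posnP #|S|; last exact: bound.
by rewrite S0; apply: ge1; rewrite ?cards1.
Qed.
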